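(* Let $G$ be a finite graph (loopless, multiple edges allowed) with a factor $F$. Let $M$ be a matching of $F$ that contains exactly one edge of every non-trivial component of $F$, where each such edge is incident to a vertex that is not a cut vertex of $F$. If $T$ is a spanning tree of $G$, then there is a connected factor $H$ of $G$ with $E(F)\setminus E(M)\subseteq E(H)$ such that for each vertex $v$, $$d_F(v)\le d_H(v)\le d_T(v)+\max\{0,d_F(v)-1\}.$$
   Context: Graphs have no loops but may have multiple edges. A factor of $G$ is a spanning subgraph; $d_X(v)$ denotes the number of edges of the graph $X$ incident to $v$. A non-trivial component of $F$ is a component containing at least one edge. A cut vertex of $F$ is a vertex whose removal increases the number of components of $F$. *)

(* Defs.v *)
From mathcomp Require Import all_boot.
Set Implicit Arguments.
Unset Strict Implicit.
Unset Printing Implicit Defensive.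

(* Parallel edges are distinct elements of [edge] with the same ends; requiring
   exactly two ends excludes loops. *)
Record multigraph := Multigraph {
  vertex : finType;
  edge : finType;
  ends : edge -> {set vertex};
  card_ends : forall e, #|ends e| = 2
}.

(* A factor (spanning subgraph) of G has all the vertices of G, so it is
   represented by its edge set. *)
Notation factor G := {set edge G}.

Section Multigraph.
Variable G : multigraph.
Implicit Types (X M : factor G) (W C : {set vertex G}) (v : vertex G).

Definition degree X v : nat := #|[set e in X | v \in ends e]|.

(* Adjacency in the subgraph of X induced by the vertex set W. *)
Definition adj X W : rel (vertex G) :=
  fun u v => [&& u \in W, v \in W & [exists e in X, ends e == [set u; v]]].

(* The vertex sets of the components of the subgraph of X induced by W. *)
Definition components X W : {set {set vertex G}} :=
  equivalence_partition (connect (adj X W)) W.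

Definition connected X : Prop := forall u v, connect (adj X setT) u v.

Definition edges_in X C : factor G := [set e in X | ends e \subset C].

Definition nontrivial_component X C : bool :=
  (C \in components X setT) && (edges_in X C != set0).

Definition cut_vertex X v : bool :=
  #|components X setT| < #|components X [set~ v]|.

Definition matching_of X M : Prop :=
  M \subset X /\ {in M &, forall e f, e != f -> [disjoint ends e & ends f]}.

(* The list (v_0, e_0), ..., (v_(k-1), e_(k-1)) stands for the closed walk in
   which e_i joins v_i to v_(i+1), indices taken modulo k. As there are no
   loops, k >= 2; since the edges are distinct, for k = 2 they are parallel. *)
Definition is_cycle X (c : seq (vertex G * edge G)) : bool :=
  [&& c != [::], all (fun p => p.2 \in X) c,
      uniq (map fst c), uniq (map snd c)
    & cycle (fun p q => ends p.2 == [set p.1; q.1]) c].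

Definition acyclic X : Prop := forall c, ~~ is_cycle X c.

Definition spanning_tree X : Prop := connected X /\ acyclic X.

End Multigraph.

(* Main.v *)
(** Write the edges of [M] as [xy] with [x] not a cut vertex of [F].  Keep a set
    [D] of edges of [T] and a set [W] of vertices such that [D] together with
    [F[W]] is connected; initially [D = T] and [W] consists of one root for each
    edge of [M].  If [v] outside [W] has an [F]-neighbour [b] in [W], then a path
    from [v] to [b] leaves [v] through an edge of [D]; this edge can be deleted
    from [D] when [v] joins [W].  So each vertex of [W] other than a root loses
    an edge of [T].  The root of [xy] is [x] if some edge of both [T] and [F] is
    incident to [x], and [y] otherwise; in the latter case [x] is only allowed
    to join once [y] has lost an edge.  At the end, [F] without the edges of [M]
    that leave [W], together with [D], is the required factor: as [x] is not a
    cut vertex, the only vertices of positive [F]-degree outside [W] are the [x]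
    whose [y] has not lost any edge. *)

Require Import Defs.
From mathcomp Require Import all_boot.

Set Implicit Arguments.
Unset Strict Implicit.
Unset Printing Implicit Defensive.

(** * Degree counting for edge sets *)

Section Degree.
Variable G : multigraph.
Implicit Types (X Y : factor G) (v : vertex G) (e : edge G).

Lemma degreeS X Y v : X \subset Y -> degree X v <= degree Y v.
Proof.
move=> /subsetP sXY; apply/subset_leq_card/subsetP => e.
by rewrite !inE => /andP[/sXY-> ->].
Qed.

Lemma degreeID X Y v : degree X v = degree (X :&: Y) v + degree (X :\: Y) v.
Proof.
rewrite /degree -(cardsID Y [set e in X | v \in ends e]).
by congr (_ + _); apply: eq_card => e; rewrite !inE; do 3?case: (_ \in _).
Qed.

Lemma degreeUD X Y v : degree (X :|: Y) v = degree X v + degree (Y :\: X) v.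
Proof. by rewrite (degreeID _ X) setUK setDUl setDv set0U. Qed.

Lemma degree_gt0P X v :
  reflect (exists2 e, e \in X & v \in ends e) (0 < degree X v).
Proof.
apply: (iffP card_gt0P) => [[e]|[e eX ve]].
  by rewrite inE => /andP[]; exists e.
by exists e; rewrite inE eX.
Qed.

Lemma degreeD1 X v e : e \in X -> v \in ends e -> degree (X :\ e) v < degree X v.
Proof.
move=> eX ve; rewrite [ltnRHS](degreeID _ [set e]) -[ltnLHS]add0n ltn_add2r.
by apply/degree_gt0P; exists e; rewrite ?inE ?eX ?eqxx.
Qed.

End Degree.

(** * Connectivity, edge exchange and components *)

Section Connectivity.
Variable G : multigraph.
Implicit Types (X Y F T D : factor G) (W : {set vertex G}).
Implicit Types (u v w : vertex G) (e : edge G).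

Lemma adj_sym X W : symmetric (adj X W).
Proof. by move=> u v; rewrite /adj andbCA setUC. Qed.

Lemma connect_adj_sym X W : connect_sym (adj X W).
Proof. exact/sym_connect_sym/adj_sym. Qed.

Lemma adjTP X u v :
  reflect (exists2 e, e \in X & ends e = [set u; v]) (adj X setT u v).
Proof.
rewrite /adj !inE /=.
apply: (iffP existsP) => [[e /andP[eX /eqP]]|[e eX ee]]; exists e => //.
by rewrite eX ee eqxx.
Qed.

Lemma set2_eq (A : {set vertex G}) u v :
  #|A| = 2 -> u \in A -> v \in A -> u != v -> A = [set u; v].
Proof.
move=> cA uA vA uv; apply/esym/eqP; rewrite eqEcard cA cards2 uv andbT.
by apply/subsetP => w; rewrite !inE => /orP[] /eqP->.
Qed.

Lemma connect_ends X e u v :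
  e \in X -> u \in ends e -> v \in ends e -> connect (adj X setT) u v.
Proof.
move=> eX ue ve; have [-> //|uv] := eqVneq u v.
apply/connect1/adjTP; exists e => //.
exact: set2_eq (card_ends e) ue ve uv.
Qed.

Lemma connect_ind (V : finType) (r : rel V) (P : V -> Prop) (u v : V) :
  (forall a b, connect r u a -> P a -> r a b -> P b) ->
  P u -> connect r u v -> P v.
Proof.
move=> IH Pu /connectP[p rp ->]; elim/last_ind: p rp => //= p w IHp.
rewrite rcons_path last_rcons => /andP[rp rw].
by apply: IH (IHp rp) rw; apply/connectP; exists p.
Qed.

Lemma connected_sub X Y :
  connected X ->
  (forall u v e, e \in X -> ends e = [set u; v] -> connect (adj Y setT) u v) ->
  connected Y.
Proof.
move=> cX sXY u v; apply: (connect_sub _ (cX u v)) => a b /adjTP[e].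
exact: sXY.
Qed.

Lemma connectedS X Y : X \subset Y -> connected X -> connected Y.
Proof.
move=> /subsetP sXY cX; apply: (connected_sub cX) => u v e /sXY eY ee.
by apply/connect1/adjTP; exists e.
Qed.

Lemma connected_degree_gt0 X u v : connected X -> u != v -> 0 < degree X u.
Proof.
move=> /(_ u v) /connectP[[/= _ ->|w p /= /andP[/adjTP[e eX ee] _] _ _]].
  by rewrite eqxx.
by apply/degree_gt0P; exists e; rewrite // ee !inE eqxx.
Qed.

(** On a simple path from [v] to [b] the first edge [g] contains [v], which is outside [W], so [g]
    is in [D]. The rest of the path avoids [v], hence [g], and together with the edge of [F] joining
    [b] to [v] it forms a detour around [g]. *)
Lemma exchange F D W v b :
  connected (D :|: edges_in F W) -> v \notin W -> b \in W ->
  adj F setT b v ->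
  exists g, [/\ g \in D, v \in ends g
    & connected ((D :\ g) :|: edges_in F (v |: W))].
Proof.
move=> cD vW bW /adjTP[f fF ef].
have /connectP[p0 p0P] := cD v b.
case/shortenP: p0P => -[/= _ _ _ bv|u p /= /andP[/adjTP[g gDF eg] up]].
  by rewrite -bv bW in vW.
rewrite inE negb_or => /andP[/andP[vu vp] _] _ b_last.
have vg : v \in ends g by rewrite eg !inE eqxx.
have gD : g \in D.
  move: gDF; rewrite !inE => /orP[//|/andP[_ /subsetP/(_ v vg)]].
  by rewrite (negPf vW).
exists g; split=> //; set Y := _ :|: _.
have keep e : e \in D :|: edges_in F W -> e != g -> e \in Y.
  rewrite !inE => + ->; case: (e \in D) => //= /andP[-> /subset_trans-> //].
  exact: subsetUr.
have ub : connect (adj Y setT) u b.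
  apply/connectP; exists p => //.
  elim: p u vu up vp {eg b_last} => //= w p IHp u vu /andP[uw wp].
  rewrite inE negb_or => /andP[vw vp]; rewrite {}IHp // andbT.
  case/adjTP: uw => e eD ee; apply/adjTP; exists e => //; apply: keep => //.
  by apply: contraTneq vg => <-; rewrite ee !inE negb_or vu.
have bv : connect (adj Y setT) b v.
  apply: (@connect_ends _ f); rewrite ?ef ?inE ?eqxx ?orbT // fF ef.
  apply/orP; right; apply/subsetP => w; rewrite !inE => /orP[]/eqP->.
    by rewrite bW orbT.
  by rewrite eqxx.
have uv := connect_trans ub bv.
apply: (connected_sub cD) => a c e eD ee.
have [eg'|ne] := eqVneq e g; last first.
  by apply/connect1/adjTP; exists e => //; apply: keep.
have: a \in ends g /\ c \in ends g by rewrite -eg' ee !inE !eqxx orbT.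
rewrite eg !inE => -[/orP[]/eqP-> /orP[]/eqP-> //].
by rewrite connect_adj_sym.
Qed.

(* [blocked D v] forbids [v] to join; the second hypothesis makes sure that
   a vertex that has joined would never be blocked later. *)
Lemma greedy_growth F T (R : {set vertex G})
    (blocked : factor G -> pred (vertex G)) :
  connected T ->
  (forall D D' v, D \subset D' -> blocked D v -> blocked D' v) ->
  exists D W,
    [/\ D \subset T, R \subset W, connected (D :|: edges_in F W),
        forall v, v \in W -> v \notin R ->
          degree D v < degree T v /\ ~~ blocked D v
      & forall b v, b \in W -> v \notin W -> adj F setT b v -> blocked D v].
Proof.
move=> cT mono.
pose inv D W := [/\ D \subset T, R \subset W, connected (D :|: edges_in F W)
  & forall v, v \in W -> v \notin R ->
      degree D v < degree T v /\ ~~ blocked D v].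
(* Induction on a bound for the number of vertices outside [W], which drops whenever a vertex
   joins. *)
suff grow n D W : #|~: W| <= n -> inv D W -> exists D W, inv D W /\
    forall b v, b \in W -> v \notin W -> adj F setT b v -> blocked D v.
  have [|D [W [[sD sR cD lost] stop]]] := grow _ T R (leqnn _).
    split=> // [|v vR]; first exact: connectedS (subsetUl _ _) cT.
    by rewrite vR.
  by exists D, W.
elim: n D W => [|n IHn] D W.
  rewrite leqn0 cards_eq0 => /eqP W0 iDW; exists D, W; split=> // b v _.
  by rewrite -in_setC W0 inE.
move=> leW iDW; have [sD sR cD lost] := iDW.
pose free b v := [&& b \in W, v \notin W, adj F setT b v & ~~ blocked D v].
have [/existsP[b /existsP[v /and4P[bW vW bv vD]]]|stuck] :=
    boolP [exists b, exists v, free b v]; last first.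
  exists D, W; split=> // b v bW vW bv; apply: contraNT stuck => vD.
  by apply/existsP; exists b; apply/existsP; exists v; apply/and4P.
have [g [gD vg cg]] := exchange cD vW bW bv.
have sDg : D :\ g \subset D by exact: subD1set.
apply: (IHn (D :\ g) (v |: W)).
  rewrite -ltnS; apply: leq_trans leW; apply: proper_card.
  by rewrite properC properE subsetUr subUset sub1set (negPf vW).
split=> //; first exact: subset_trans sDg sD.
  exact: subset_trans sR (subsetUr _ _).
(* The new vertex [v] loses [g]. Replacing [D] by [D :\ g] raises no degree and, by [mono], blocks
   no further vertex. *)
move=> w; rewrite !inE => /predU1P[-> _|wW wR]; split.
- exact: leq_trans (degreeD1 gD vg) (degreeS _ sD).
- by apply: contra vD; apply: mono.
- by apply: leq_ltn_trans (degreeS _ sDg) _; have [] := lost w wW wR.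
- by have [_] := lost w wW wR; apply: contra; apply: mono.
Qed.

(* Sending each component of [X - x] to the component of [X] containing it is
   onto, since the component of [x] also contains [y]; as [x] is not a cut
   vertex, it is one-to-one. *)
Lemma connect_avoiding X x y z :
  ~~ cut_vertex X x -> y != x -> z != x ->
  connect (adj X setT) x y -> connect (adj X setT) y z ->
  connect (adj X [set~ x]) y z.
Proof.
rewrite /cut_vertex -leqNgt => le_comp yx zx xy yz.
pose psi (P : {set vertex G}) :=
  [set w | [exists p in P, connect (adj X setT) p w]].
pose cls u := [set w in [set~ x] | connect (adj X [set~ x]) u w].
have sub u w : connect (adj X [set~ x]) u w -> connect (adj X setT) u w.
  apply: connect_sub => a b /and3P[_ _ ab]; apply/connect1.
  by rewrite /adj !inE.
have clsx u : u != x -> u \in cls u by move=> ux; rewrite !inE ux /=.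
have clsP u : u != x -> cls u \in components X [set~ x].
  by move=> ux; apply/imsetP; exists u; rewrite ?inE.
have psiE u : u != x -> psi (cls u) = [set w in setT | connect (adj X setT) u w].
  move=> ux; apply/setP => w; rewrite !inE /=.
  apply/existsP/idP => [[p]|uw]; last by exists u; rewrite clsx.
  rewrite !inE => /andP[/andP[_ /sub up]]; exact: connect_trans.
have onto : components X setT \subset psi @: components X [set~ x].
  apply/subsetP => _ /imsetP[u _ ->].
  have [-> | ux] := eqVneq u x.
    apply/imsetP; exists (cls y); rewrite ?clsP // psiE //.
    apply/setP => w; rewrite !inE /=.
    exact: same_connect (@connect_adj_sym _ _) _ _ xy w.
  by apply/imsetP; exists (cls u); rewrite ?clsP // psiE.
have /imset_injP inj_psi :
    #|psi @: components X [set~ x]| == #|components X [set~ x]|.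
  rewrite eqn_leq leq_imset_card /=; apply: leq_trans le_comp _.
  exact: subset_leq_card.
have /setP/(_ z) : cls y = cls z.
  apply: inj_psi; rewrite ?clsP // !psiE //; apply/setP => w; rewrite !inE /=.
  exact: same_connect (@connect_adj_sym _ _) _ _ yz w.
by rewrite clsx // inE => /andP[].
Qed.

(** Turns the count per component into reachability from [v]: the component [C] of [v] is
    non-trivial because [v] has an incident edge, and every edge of [F] with an end reachable from
    [v] lies inside [C]. *)
Lemma component_matching_edge F (M : factor G) v :
  M \subset F ->
  (forall C, nontrivial_component F C -> #|M :&: edges_in F C| = 1) ->
  0 < degree F v ->
  exists e, [/\ e \in M, forall w, w \in ends e -> connect (adj F setT) v w
    & forall e' w, e' \in M -> w \in ends e' -> connect (adj F setT) v w ->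
        e' = e].
Proof.
move=> /subsetP sMF oneM /degree_gt0P[f fF vf].
pose C := [set w in setT | connect (adj F setT) v w].
have edgesC e w : e \in F -> w \in ends e -> connect (adj F setT) v w ->
    e \in edges_in F C.
  move=> eF we vw; rewrite inE eF; apply/subsetP => a ae; rewrite !inE /=.
  exact: connect_trans vw (connect_ends eF we ae).
have /eqP/cards1P[e Me] : #|M :&: edges_in F C| = 1.
  apply: oneM; apply/andP; split; first by apply/imsetP; exists v.
  by apply/set0Pn; exists f; apply: edgesC vf _.
have: e \in M :&: edges_in F C by rewrite Me set11.
rewrite !inE => /and3P[eM _ /subsetP eC]; exists e; split=> // [w /eC|e' w e'M].
  by rewrite !inE.
move=> we' vw; apply/set1P; rewrite -Me inE e'M.
exact: edgesC (sMF _ e'M) we' vw.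
Qed.

End Connectivity.

(** * Construction of the connected factor and its degree bounds *)

Theorem theorem2p1 (G : multigraph) (F M T : factor G) :
  matching_of F M ->
  (forall C : {set vertex G}, nontrivial_component F C ->
     #|M :&: edges_in F C| = 1) ->
  (forall e : edge G, e \in M ->
     exists2 v : vertex G, v \in ends e & ~~ cut_vertex F v) ->
  spanning_tree T ->
  exists H : factor G,
    [/\ connected H,
        F :\: M \subset H &
        forall v : vertex G,
          degree F v <= degree H v <= degree T v + maxn 0 (degree F v - 1)].
Proof.
move=> [sMF disM] oneM noncutM [cT _].
have matchE e e' v : e \in M -> e' \in M -> v \in ends e -> v \in ends e' ->
    e = e'.
  move=> eM e'M ve ve'; apply: contraTeq ve' => ne.
  by rewrite (disjointFr (disM _ _ eM e'M ne) ve).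
(* The ends of all edges are ordered at once; outside [M] any order serves. *)
have /fin_all_exists[xy xyP] (e : edge G) : exists p : vertex G * vertex G,
    [/\ p.1 != p.2, ends e = [set p.1; p.2] & e \in M -> ~~ cut_vertex F p.1].
  have [x xe ncx] : exists2 x, x \in ends e & e \in M -> ~~ cut_vertex F x.
    have [/noncutM[x xe ncx]|_] := boolP (e \in M); first by exists x.
    have /card_gt0P[x xe] : 0 < #|ends e| by rewrite card_ends.
    by exists x.
  have /card_gt0P[y] : 0 < #|ends e :\ x|.
    by have := cardsD1 x (ends e); rewrite card_ends xe add1n => -[<-].
  rewrite !inE => /andP[yx ye]; exists (x, y); split=> //=; first by rewrite eq_sym.
  by apply: set2_eq; rewrite ?card_ends // eq_sym.
pose x e := (xy e).1; pose y e := (xy e).2.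
have x_y e : x e != y e by have [] := xyP e.
have endsE e : ends e = [set x e; y e] by have [] := xyP e.
have xe e : x e \in ends e by rewrite endsE !inE eqxx.
have ye e : y e \in ends e by rewrite endsE !inE eqxx orbT.
have ncx e : e \in M -> ~~ cut_vertex F (x e) by have [] := xyP e.
have FM e : e \in M -> e \in F by apply/subsetP.
pose touch e := 0 < degree (T :&: F) (x e).
pose root e := if touch e then x e else y e.
have root_e e : root e \in ends e by rewrite /root; case: ifP.
(* The loss at [y e] is measured on [D :\: F], so a tree edge at [y e] that lies in [F] also counts
   as lost. *)
pose blocked (D : factor G) v := [exists e in M,
  [&& v == x e, ~~ touch e & degree T (y e) <= degree (D :\: F) (y e)]].
have blockedS (D D' : factor G) v : D \subset D' -> blocked D v -> blocked D' v.
  move=> sD /exists_inP[e eM /and3P[ve te le_y]]; apply/exists_inP; exists e => //.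
  by rewrite ve te (leq_trans le_y) // degreeS // setSD.
have [D [W [sDT sRW cD lost stop]]] := greedy_growth F (root @: M) cT blockedS.
have rootW e : e \in M -> root e \in W.
  by move=> eM; apply: (subsetP sRW); apply: imset_f.
(* In the component of [v] only [x e] can be blocked, and only if [~~ touch e]. Any other vertex is
   reached from [root e] by a path which in that case avoids [x e], so membership in [W] spreads
   along it. *)
have outside v : 0 < degree F v -> v \notin W -> blocked D v.
  move=> dv vW; have [e [eM ve uniq_e]] := component_matching_edge sMF oneM dv.
  pose U := if touch e then setT else [set~ x e].
  have adjU a b : adj F U a b -> adj F setT a b.
    by case/and3P=> _ _ ab; rewrite /adj !inE.
  have [vx|nv] := boolP (~~ touch e && (v == x e)).
    have{vx} /andP[te /eqP vx] := vx.
    apply: (stop (y e)) => //; first by have := rootW e eM; rewrite /root (negPf te).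
    by apply/adjTP; exists e; rewrite ?FM // endsE vx setUC.
  have root_v : connect (adj F U) (root e) v.
    have cr : connect (adj F setT) (root e) v.
      by rewrite connect_adj_sym ve.
    move: nv cr; rewrite /root /U; case: ifP => //= _ vx cr.
    apply: connect_avoiding cr; rewrite ?ncx //; first by rewrite eq_sym.
    exact: connect_ends (FM _ eM) _ _.
  case/negP: vW.
  apply: (connect_ind (P := fun a => a \in W) _ (rootW e eM) root_v) => a b ra aW ab.
  apply: contraT => bW.
  have /exists_inP[e' e'M /and3P[/eqP bx te' _]] := stop a b aW bW (adjU _ _ ab).
  have Ee : e' = e.
    apply: (uniq_e e' b) => //; first by rewrite bx.
    apply: connect_trans (ve _ (root_e e)) _.
    apply: connect_trans (connect1 (adjU _ _ ab)).
    by apply: connect_sub ra => c d /adjU/connect1.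
  move: ab; rewrite /U bx; rewrite Ee in te' *.
  by rewrite (negPf te') => /and3P[_ + _]; rewrite !inE eqxx.
(* [H] will lack exactly these edges of [F]. For each of them [x e] stayed blocked, so all tree
   edges at [y e] are still in [D] and none is in [F]. *)
pose N := [set e in M | ~~ (ends e \subset W)].
have NP e : e \in N -> [/\ e \in M, x e \notin W, ~~ touch e
    & degree T (y e) <= degree (D :\: F) (y e)].
  rewrite inE => /andP[eM /subsetPn[w we wW]].
  have dw : 0 < degree F w by apply/degree_gt0P; exists e; rewrite ?FM.
  have /exists_inP[e' e'M /and3P[/eqP wx te le_y]] := outside w dw wW.
  have Ee : e' = e by apply: (matchE e' e w); rewrite // wx.
  by move: wW te le_y; rewrite wx Ee.
have touchP e f : ~~ touch e -> f \in T -> f \in F -> x e \notin ends f.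
  move=> te fT fF; apply: contra te => xf.
  by apply/degree_gt0P; exists f; rewrite // inE fT.
have ND e : e \in N -> e \notin D.
  move=> /NP[eM _ te _]; apply: contraL (xe e) => /(subsetP sDT) eT.
  by apply: touchP te eT (FM _ eM).
pose H := (F :\: N) :|: D.
(* By [ND], [D] avoids [N], so it adds exactly [D :\: F] to [F :\: N]. *)
have degH v : degree H v = degree (F :\: N) v + degree (D :\: F) v.
  rewrite degreeUD; congr (_ + degree _ v); apply/setP => e; rewrite !inE.
  have := ND e; rewrite inE; case: (e \in M) => //=.
  by case: (e \in D); case: (e \in F); case: (_ \subset _) => //= /(_ isT).
exists H; split.
- apply: connectedS cD; apply/subsetP => e; rewrite !inE.
  by case/orP=> [->|/andP[-> ->]]; rewrite ?orbT ?andbF.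
- apply/subsetP => e; rewrite !inE => /andP[/negPf-> ->] //.
move=> v; rewrite max0n degH subn1.
have leDT : degree (D :\: F) v <= degree T v.
  exact: degreeS (subset_trans (subsetDl _ _) sDT).
(* At an end of an edge of [N] the matching property makes the degree drop by exactly one. One edge
   of [D :\: F] at [v] then restores the lower bound, and [leDT] gives the upper one. *)
have [/degree_gt0P[e]|] := boolP (0 < degree (F :&: N) v).
  rewrite inE => /andP[eF eN] ve; have [eM xW te le_y] := NP e eN.
  have dF : degree F v = (degree (F :\: N) v).+1.
    rewrite (degreeID _ N) -add1n; congr (_ + _).
    apply/eqP/cards1P; exists e; apply/setP => e'; rewrite [RHS]inE.
    apply/idP/eqP => [|->]; last by rewrite inE inE eF eN.
    rewrite inE inE => /andP[/andP[_ /NP[e'M _ _ _]] ve'].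
    exact: matchE ve' ve.
  suff dD : 0 < degree (D :\: F) v.
    by rewrite dF /= -addn1 leq_add2l dD [leqRHS]addnC leq_add2l.
  move: ve; rewrite endsE !inE => /orP[] /eqP->; last first.
    apply: leq_trans le_y; apply: (connected_degree_gt0 (v := x e) cT).
    by rewrite eq_sym x_y.
  (* As [x e] is outside [W], connectedness forces an edge of [D] there, and it is not in [F]
     because [T] and [F] share no edge at [x e]. *)
  have /degree_gt0P[f] := connected_degree_gt0 cD (x_y e).
  rewrite !inE => /orP[fD|/andP[_ /subsetP sfW]] xf; last first.
    by rewrite sfW in xW.
  apply/degree_gt0P; exists f; rewrite // inE fD andbT.
  by apply: contraL xf => fF; apply: touchP te (subsetP sDT _ fD) fF.
rewrite -eqn0Ngt => /eqP dN.
have vN e : e \in N -> v \notin ends e.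
  move=> eN; apply: contra_eqN dN => ve; rewrite -lt0n; apply/degree_gt0P.
  by exists e; rewrite // inE eN FM //; case: (NP e eN).
have -> : degree (F :\: N) v = degree F v by rewrite [RHS](degreeID _ N) dN.
rewrite leq_addr /= addnC.
have [->|dF] := posnP (degree F v); first by rewrite !addn0.
(* Here [v] keeps all its edges of [F], so the term [degree F v - 1] requires some tree edge at [v]
   to be missing from [D :\: F]. *)
suff lt_v : degree (D :\: F) v < degree T v.
  by rewrite -[X in _ + X <= _](prednK dF) addnS -addSn leq_add2r.
have vW : v \in W.
  apply: contraT => vW.
  have /exists_inP[e eM /and3P[/eqP vx _ _]] := outside v dF vW.
  suff /vN : e \in N by rewrite vx xe.
  by rewrite inE eM; apply/subsetPn; exists v => //; rewrite vx.
have [/imsetP[e eM vr]|vR] := boolP (v \in root @: M); last first.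
  apply: leq_ltn_trans (degreeS _ (subsetDl _ _)) _.
  by have [] := lost v vW vR.
have eW : ends e \subset W.
  by apply: contraLR (root_e e) => eW; rewrite -vr vN // inE eM.
have [te|te] := boolP (touch e).
  (* Here [v] is [x e], and an edge common to [T] and [F] there is not in [D :\: F]. *)
  apply: leq_ltn_trans (degreeS _ (setSD F sDT)) _.
  by rewrite [ltnRHS](degreeID _ F) -[ltnLHS]add0n ltn_add2r vr /root te.
have rE : root e = y e by rewrite /root (negPf te).
(* Now [v] is [y e], while [x e] is in [W] without being a root. So [x e] is not blocked, which
   means that [y e] has lost a tree edge. *)
have xR : x e \notin root @: M.
  apply/imsetP => -[e' e'M xr].
  have Ee : e' = e by apply: (matchE e' e (x e)); rewrite // xr.
  by have := x_y e; rewrite -rE xr Ee eqxx.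
have [_] := lost _ (subsetP eW _ (xe e)) xR.
apply: contraR; rewrite -leqNgt vr rE => le_y.
by apply/exists_inP; exists e; rewrite // eqxx te.
Qed.
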